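(* Let $G$ be the group with presentation $$G=\langle a,b,c,s,t\mid c=ab=ba,\ c^2=sas^{-1}=tbt^{-1}\rangle$$ and let $\ell$ be the word length on $G$ with respect to the generators $a,b,c,s,t$. Then $G$ has the property of rapid decay relative to $\ell$: there exists a polynomial $P$ such that for every $r\in\mathbb{R}_+$ and all $f,g\in\mathbb{C}G$ with $\operatorname{supp}(f)\subset B_r$, one has $$\|f*g\|_2\le P(r)\,\|f\|_2\,\|g\|_2 .$$
   Context: $\mathbb{C}G$ is the complex group algebra of $G$ (finitely supported functions $G\to\mathbb{C}$) with convolution product $*$; $\|\cdot\|_2$ is the $\ell^2$-norm on functions on $G$; $\operatorname{supp}(f)=\{x\in G: f(x)\ne 0\}$; $B_r=\{x\in G:\ell(x)\le r\}$. *)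

(* Defs.v *)
From HB Require Import structures.
From mathcomp Require Import all_boot all_order all_algebra.
From mathcomp Require Import finmap complex.
From mathcomp Require Import boolp reals.

Set Implicit Arguments.
Unset Strict Implicit.
Unset Printing Implicit Defensive.

Import GRing.Theory Num.Theory.

Local Open Scope fset_scope.
Local Open Scope ring_scope.
Local Open Scope quotient_scope.

(* The letter (x, false) stands for the generator x, (x, true) for its
   inverse; a word denotes the product of its letters, left to right. *)
Definition word (X : Type) : Type := seq (X * bool).

Definition inv_letter (X : Type) (l : X * bool) : X * bool := (l.1, ~~ l.2).

Definition inv_word (X : Type) (w : word X) : word X :=
  rev (map (@inv_letter X) w).

Section Presentation.
Context (X : choiceType) (rels : seq (word X * word X)).

(* Two words are related iff they denote the same element of < X | rels >.
   Taking both signs in pres_cancel makes x and x^-1 mutually inverse. *)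
Inductive pres_eq : word X -> word X -> Prop :=
| pres_refl u : pres_eq u u
| pres_sym u v : pres_eq u v -> pres_eq v u
| pres_trans v u w : pres_eq u v -> pres_eq v w -> pres_eq u w
| pres_cat u u' v v' :
    pres_eq u u' -> pres_eq v v' -> pres_eq (u ++ v) (u' ++ v')
| pres_cancel l : pres_eq [:: l; inv_letter l] [::]
| pres_rel u v : (u, v) \in rels -> pres_eq u v.

Definition pres_eqb (u v : word X) : bool := `[< pres_eq u v >].

Lemma pres_eqb_refl : reflexive pres_eqb.
Proof. by move=> u; apply/asboolP; exact: pres_refl. Qed.

Lemma pres_eqb_sym : symmetric pres_eqb.
Proof. by move=> u v; apply/asboolP/asboolP; exact: pres_sym. Qed.

Lemma pres_eqb_trans : transitive pres_eqb.
Proof.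
move=> v u w /asboolP uv /asboolP vw; apply/asboolP.
exact: pres_trans uv vw.
Qed.

Canonical pres_equiv :=
  EquivRel pres_eqb pres_eqb_refl pres_eqb_sym pres_eqb_trans.

Definition pres_group := {eq_quot pres_eqb}.

HB.instance Definition _ := Choice.on pres_group.
HB.instance Definition _ := EqQuotient.on pres_group.

Lemma pi_pres_eq (u v : word X) :
  \pi_pres_group u = \pi_pres_group v <-> pres_eq u v.
Proof.
by split=> [/eqmodP/asboolP // | uv]; apply/eqmodP/asboolP.
Qed.

Definition pres_one : pres_group := \pi_pres_group [::].

Definition pres_mul (x y : pres_group) : pres_group :=
  \pi_pres_group ((repr x : word X) ++ (repr y : word X)).

Definition pres_inv (x : pres_group) : pres_group :=
  \pi_pres_group (inv_word (repr x)).

Lemma pres_eq_repr (u : word X) : pres_eq (repr (\pi_pres_group u)) u.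
Proof. by apply/pi_pres_eq; rewrite reprK. Qed.

Lemma pres_mul_pi (u v : word X) :
  pres_mul (\pi_pres_group u) (\pi_pres_group v) = \pi_pres_group (u ++ v).
Proof. by apply/pi_pres_eq; apply: pres_cat; exact: pres_eq_repr. Qed.

Lemma pres_mulA : associative pres_mul.
Proof.
elim/quotW=> u; elim/quotW=> v; elim/quotW=> w.
by rewrite (pres_mul_pi v w) (pres_mul_pi u v) !pres_mul_pi catA.
Qed.

Lemma pres_mul1g : left_id pres_one pres_mul.
Proof. by elim/quotW=> u; rewrite pres_mul_pi. Qed.

Lemma pres_mulg1 : right_id pres_one pres_mul.
Proof. by elim/quotW=> u; rewrite pres_mul_pi cats0. Qed.

Lemma inv_letterK : involutive (@inv_letter X).
Proof. by case=> x b; rewrite /inv_letter /= negbK. Qed.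

Lemma inv_wordK : involutive (@inv_word X).
Proof.
by move=> w; rewrite /inv_word map_rev revK mapK //; exact: inv_letterK.
Qed.

Lemma pres_eq_catV (w : word X) : pres_eq (w ++ inv_word w) [::].
Proof.
elim: w => [|l w IHw]; first exact: pres_refl.
rewrite /inv_word /= rev_cons -/(inv_word w) -cats1 catA -cat1s.
apply: pres_trans (pres_cancel l).
rewrite -[[:: l; _]]/([:: l] ++ ([::] ++ [:: inv_letter l])).
apply: pres_cat; first exact: pres_refl.
by apply: pres_cat => //; exact: pres_refl.
Qed.

Lemma pres_mulgV : right_inverse pres_one pres_inv pres_mul.
Proof.
move=> x; rewrite -{1}[x]reprK pres_mul_pi.
by apply/pi_pres_eq; exact: pres_eq_catV.
Qed.

Lemma pres_mulVg : left_inverse pres_one pres_inv pres_mul.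
Proof.
move=> x; rewrite -{2}[x]reprK pres_mul_pi.
by apply/pi_pres_eq; rewrite -{2}(inv_wordK (repr x)); exact: pres_eq_catV.
Qed.

HB.instance Definition _ := isGroup.Build pres_group
  pres_mulA pres_mul1g pres_mulg1 pres_mulVg pres_mulgV.

Definition is_word_size (x : pres_group) : pred nat :=
  fun n => `[< exists2 w : word X, \pi_pres_group w = x & size w = n >].

Lemma ex_word_size (x : pres_group) : exists n, is_word_size x n.
Proof.
exists (size (repr x : word X)); apply/asboolP.
by exists (repr x); first exact: reprK.
Qed.

Definition word_length (x : pres_group) : nat := ex_minn (ex_word_size x).

End Presentation.

Section GroupAlgebra.
Context (R : realType) (G : groupType).

Definition group_algebra := {fsfun G -> R[i] with 0}.

Implicit Types f g : group_algebra.

(* The sum vanishes outside the given finite set, see convE. *)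
Definition conv f g : group_algebra :=
  [fsfun x in [fset (y * z)%g | y in finsupp f, z in finsupp g] =>
    \sum_(y <- finsupp f) f y * g (y^-1 * x)%g].

Lemma convE f g (x : G) :
  conv f g x = \sum_(y <- finsupp f) f y * g (y^-1 * x)%g.
Proof.
rewrite fsfunE; case: ifPn => // xN; rewrite big_seq big1 // => y yf.
rewrite [g _]fsfun_dflt ?mulr0 //; apply: contra xN => zg.
apply/imfset2P; exists y => //; exists (y^-1 * x)%g => //.
by rewrite mulgA mulgV mul1g.
Qed.

Definition l2norm f : R :=
  Num.sqrt (\sum_(x <- finsupp f) Normc.normc (f x) ^+ 2).

Definition ball (l : G -> nat) (r : R) : pred G := fun x => (l x)%:R <= r.

Definition rapid_decay (l : G -> nat) : Prop :=
  exists P : {poly R}, forall (r : R), 0 <= r ->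
    forall f g : group_algebra,
      {subset finsupp f <= ball l r} ->
      l2norm (conv f g) <= P.[r] * l2norm f * l2norm g.

End GroupAlgebra.

Inductive gen := gen_a | gen_b | gen_c | gen_s | gen_t.

Definition nat_of_gen (x : gen) : nat :=
  match x with
  | gen_a => 0 | gen_b => 1 | gen_c => 2 | gen_s => 3 | gen_t => 4
  end.

Definition gen_of_nat (n : nat) : gen :=
  nth gen_t [:: gen_a; gen_b; gen_c; gen_s; gen_t] n.

Lemma nat_of_genK : cancel nat_of_gen gen_of_nat.
Proof. by case. Qed.

HB.instance Definition _ := Countable.copy gen (can_type nat_of_genK).

(* < a, b, c, s, t | c = ab = ba, c^2 = sas^-1 = tbt^-1 >, each chain of
   equalities being split into its two consecutive equations. *)
Definition G_rels : seq (word gen * word gen) :=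
  let a := (gen_a, false) in let a' := (gen_a, true) in
  let b := (gen_b, false) in
  let c := (gen_c, false) in
  let s := (gen_s, false) in let s' := (gen_s, true) in
  let t := (gen_t, false) in let t' := (gen_t, true) in
  [:: ([:: c], [:: a; b]);
      ([:: a; b], [:: b; a]);
      ([:: c; c], [:: s; a; s']);
      ([:: s; a; s'], [:: t; b; t'])].

Definition G : groupType := pres_group G_rels.

Definition G_length : G -> nat := @word_length gen G_rels.

(* Main.v *)
(* G is a double HNN extension of the vertex group A = <a, b> = Z^2, hence acts
   on its Bass-Serre tree, with root v. For z = x y the geodesic triangle v, xv,
   zv has a centre w, which lies on the geodesics [v, xv] and [v, zv] and whose
   translate by x^-1 lies on [v, yv]. If x has length at most n, there are at most
   (n + 1)^2 choices for the positions (i, j) of w on [v, xv] and of x^-1 w on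
   [v, yv]. For fixed (i, j), Cauchy-Schwarz bounds the corresponding part of the
   convolution by sqrt M |f| |g|, where M bounds the number of elements of length
   at most n which map one given vertex to another.

   M is quadratic in n: an element mapping the vertex p to q is determined by the
   vector of A measuring its effect on the coset representatives of p and q, and
   this vector is a cocycle, so it suffices to bound it for generators. This holds
   because the edge subgroups <a>, <b>, <c^2> have representatives for which the
   carry of a product contracts from one edge to the next: the projections of A
   onto these lines map each of the other two with ratio less than 1, which
   reflects the CAT(0) geometry with |a| = |b| = |c^2|. *)

From HB Require Import structures.
Require Import Defs.
From mathcomp Require Import all_boot all_order all_algebra.
From mathcomp Require Import finmap complex.
From mathcomp Require Import boolp reals.
From mathcomp Require Import zify ring lra.

Set Implicit Arguments.
Unset Strict Implicit.
Unset Printing Implicit Defensive.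

Import Order.TTheory GRing.Theory Num.Theory.

Local Open Scope quotient_scope.
Local Open Scope ring_scope.

(** * Rooted trees whose vertices are paths from the root *)

Section TreeDistance.
Context {T : eqType}.
Implicit Types L M : seq T.

Fixpoint tree_dist L M : nat :=
  match L, M with
  | x :: L', y :: M' =>
      if x == y then tree_dist L' M' else ((size L').+1 + (size M').+1)%N
  | [::], _ => size M
  | _, [::] => size L
  end.

(** The centre of the geodesic triangle spanned by the root, [L] and [M]. *)
Fixpoint common_prefix L M : seq T :=
  match L, M with
  | x :: L', y :: M' => if x == y then x :: common_prefix L' M' else [::]
  | _, _ => [::]
  end.

Lemma tree_dist_cons x L M : tree_dist (x :: L) (x :: M) = tree_dist L M.
Proof. by rewrite /= eqxx. Qed.

Lemma common_prefixC L M : common_prefix L M = common_prefix M L.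
Proof.
elim: L M => [|x L IH] [|y M] //=; rewrite eq_sym.
by case: eqP => // ->; rewrite IH.
Qed.

Lemma common_prefixE L M :
  common_prefix L M = take (size (common_prefix L M)) L.
Proof.
elim: L M => [|x L IH] [|y M] //=; case: eqP => //= _; by rewrite -IH.
Qed.

Lemma size_common_prefix L M :
  (size (common_prefix L M) + tree_dist L (common_prefix L M) = size L)%N.
Proof.
elim: L M => [|x L IH] [|y M] //=; case: eqP => //= _.
by rewrite eqxx addSn IH.
Qed.

Lemma tree_dist_common_prefix L M :
  (tree_dist L (common_prefix L M) + tree_dist (common_prefix L M) M =
   tree_dist L M)%N.
Proof.
elim: L M => [|x L IH] [|y M] //=; first by rewrite addn0.
by case: eqP => [<-|_] //=; rewrite eqxx IH.
Qed.

(** Once two paths part, their distance exceeds the difference of their sizes, so equality puts [q]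
    on the geodesic from the root to [L]. *)
Lemma prefix_of_tree_dist q L :
  (size q + tree_dist q L = size L)%N -> q = take (size q) L.
Proof.
elim: q L => [|x q IH] [|y L] //=.
by case: eqP => [<-|_] h; [rewrite -IH //|]; lia.
Qed.

End TreeDistance.

(** * Edge subgroups of Z^2, rounded projections and coset representatives *)

(* The edge (false, _) belongs to the stable letter s and (true, _) to t; the
   second component marks the inverse letter. *)
Definition edge : Type := bool * bool.
Definition inv_edge (e : edge) : edge := (e.1, ~~ e.2).
Definition Z2 : Type := int * int.
HB.instance Definition _ := GRing.Zmodule.on Z2.

Lemma inv_edgeK : involutive inv_edge.
Proof. by case=> [[] []]. Qed.

(* The vertex group <a, b> is Z^2; [ray e] parametrizes the subgroup which the
   stable letter e conjugates into the vertex group: <c^2>, <a> or <b>. *)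
Definition ray (e : edge) (k : int) : Z2 :=
  match e with
  | (_, false) => (2 * k, 2 * k)
  | (false, true) => (k, 0)
  | (true, true) => (0, k)
  end.

(* Rounded linear projections of Z^2 onto the subgroups [ray e]. The slopes
   are chosen so that each projection maps the two other subgroups into its
   own with ratio less than 1 (up to rounding); cf. [proj_ray_le]. *)
Definition proj (e : edge) (h : Z2) : int :=
  match e with
  | (_, false) => (h.1 %/ 2)%Z
  | (false, true) => h.1 - (3 * h.2 %/ 4)%Z
  | (true, true) => h.2 - (3 * h.1 %/ 4)%Z
  end.

Definition coset_repr (e : edge) (h : Z2) : Z2 := h - ray e (proj e h).

Lemma Z2P (h h' : Z2) : h.1 = h'.1 -> h.2 = h'.2 -> h = h'.
Proof. by case: h h' => [m n] [m' n'] /= -> ->. Qed.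

Lemma Z2add1 (h h' : Z2) : (h + h').1 = h.1 + h'.1. Proof. by []. Qed.
Lemma Z2add2 (h h' : Z2) : (h + h').2 = h.2 + h'.2. Proof. by []. Qed.

Lemma rayD e k l : ray e (k + l) = ray e k + ray e l.
Proof.
by apply: Z2P; rewrite ?Z2add1 ?Z2add2; case: e => [[] []] /=; lia.
Qed.

Lemma ray0 e : ray e 0 = 0.
Proof. by case: e => [[] []]. Qed.

Lemma rayB e k l : ray e (k - l) = ray e k - ray e l.
Proof. by apply: (addIr (ray e l)); rewrite -rayD !subrK. Qed.

Lemma proj0 e : proj e 0 = 0.
Proof. by case: e => [[] []]. Qed.

(** Despite the rounding, the projection is exact along its own subgroup; this makes [coset_repr e]
    constant on cosets. *)
Lemma projD_ray e h k : proj e (h + ray e k) = proj e h + k.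
Proof.
by rewrite /proj !Z2add1 !Z2add2; case: e => [[] []] /=; lia.
Qed.

Lemma projB_ray e h k : proj e (h - ray e k) = proj e h - k.
Proof.
by rewrite -[in RHS](subrK (ray e k) h) projD_ray addrK.
Qed.

Lemma proj_coset_repr e h : proj e (coset_repr e h) = 0.
Proof. by rewrite projB_ray subrr. Qed.

Lemma coset_reprE e h : coset_repr e h + ray e (proj e h) = h.
Proof. exact: subrK. Qed.

(** The bound 4 reproduces itself: a different subgroup is projected with ratio at most 3/4 and
    rounding adds at most 1, while 3/4 * 4 + 1 = 4. On its own subgroup the projection is exact. *)
Lemma proj_ray_le e e' r (k : int) :
  proj e r = 0 -> (`|k| <= 4)%N -> (`|proj e (r + ray e' k)%R|%N <= 4)%N.
Proof.
by rewrite /proj !Z2add1 !Z2add2; case: r => m n;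
  case: e => [[] []]; case: e' => [[] []] /=; lia.
Qed.

Lemma proj_unit_le e r (h : Z2) :
  proj e r = 0 -> (`|h.1| <= 1)%N -> (`|h.2| <= 1)%N ->
  (`|proj e (r + h)%R|%N <= 4)%N.
Proof.
by rewrite /proj !Z2add1 !Z2add2; case: r => m n; case: e => [[] []] /=; lia.
Qed.

Arguments ray : simpl never.
Arguments proj : simpl never.
Arguments inv_edge : simpl never.

(** * Vertices as normal forms, and the isometries given by Z^2 and the stable letters *)

(* A vertex of the Bass-Serre tree is the list [:: (r1, e1); ...; (rk, ek)] of
   the normal form r1 e1 ... rk ek of its coset. *)
Definition step : Type := (Z2 * edge)%type.
HB.instance Definition _ := Equality.on step.

Lemma step_eqE (r r' : Z2) (e e' : edge) :
  ((r, e) == (r', e') :> step) = (r == r') && (e == e').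
Proof. by []. Qed.

Definition no_backtrack (u v : step) : bool :=
  ~~ ((v.1 == 0) && (v.2 == inv_edge u.2)).

Definition repr_step (u : step) : bool := proj u.2 u.1 == 0.

Definition vertex (L : seq step) : bool :=
  all repr_step L && sorted no_backtrack L.

(** Left multiplication by [h]: the part of [r + h] in [ray e] passes the stable letter, becomes an
    element of [ray (inv_edge e)], and acts on the rest. *)
Fixpoint shift (h : Z2) (L : seq step) : seq step :=
  if L is (r, e) :: L' then
    (coset_repr e (r + h), e) :: shift (ray (inv_edge e) (proj e (r + h))) L'
  else [::].

(** What remains of [h] at the right end of the normal form; see [shift_carry]. *)
Fixpoint carry (h : Z2) (L : seq step) : Z2 :=
  if L is (r, e) :: L' then carry (ray (inv_edge e) (proj e (r + h))) L'
  else h.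

Definition cross (e : edge) (L : seq step) : seq step :=
  if L is (r, e') :: L' then
    if (r == 0) && (e' == inv_edge e) then L' else (0, e) :: L
  else [:: (0, e)].

Lemma shiftD h h' L : shift h (shift h' L) = shift (h + h') L.
Proof.
elim: L h h' => [|[r e] L IH] h h' //=.
have E : coset_repr e (r + h') + h =
         r + (h + h') - ray e (proj e (r + h')).
  by rewrite /coset_repr addrAC (addrC h) !addrA.
congr ((_, _) :: _); first by rewrite E /coset_repr projB_ray rayB opprB addrA subrK.
by rewrite IH -rayD E projB_ray subrK.
Qed.

Lemma shift0 L : all repr_step L -> shift 0 L = L.
Proof.
elim: L => [|[r e] L IH] //= /andP[/eqP /= r0 /IH sL].
by rewrite addr0 /coset_repr r0 !ray0 subr0 sL.
Qed.

Lemma size_shift h L : size (shift h L) = size L.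
Proof. by elim: L h => [|[r e] L IH] h //=; rewrite IH. Qed.

Lemma coset_repr_ray e r k :
  proj e r = 0 -> coset_repr e (r + ray e k) = r.
Proof. by move=> r0; rewrite /coset_repr projD_ray r0 add0r addrK. Qed.

Lemma coset_repr_inj e r r' h :
  proj e r = 0 -> proj e r' = 0 ->
  coset_repr e (r + h) = coset_repr e (r' + h) -> r = r'.
Proof.
move=> r0 r'0 /eqP; rewrite /coset_repr subr_eq => /eqP E.
have rr' : r = r' + ray e (proj e (r + h) - proj e (r' + h)).
  apply: (addIr h); rewrite [LHS]E rayB [RHS]addrAC -[LHS]addrA.
  by rewrite (addrC (- _)).
have := congr1 (proj e) rr'; rewrite projD_ray r0 r'0 add0r => k0.
by rewrite rr' -k0 ray0 addr0.
Qed.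

Lemma all_repr_shift h L : all repr_step (shift h L).
Proof.
elim: L h => [|[r e] L IH] h //=.
by rewrite IH andbT /repr_step /= proj_coset_repr.
Qed.

(** The vector that has passed [u] lies in [ray (inv_edge u.2)], so a following step over the
    inverse edge keeps its representative; hence no new backtracking appears. *)
Lemma no_backtrack_shift u h L :
  all repr_step L -> path no_backtrack u L ->
  path no_backtrack u (shift (ray (inv_edge u.2) h) L).
Proof.
elim: L u h => [|[r e] L IH] u h //= /andP[/eqP /= r0 aL] /andP[uv vL].
apply/andP; split; last by apply: (IH (_, e)) => //; case: (L) vL.
apply: contra uv; rewrite /no_backtrack /= => /andP[/eqP x0 /eqP Ee].
by move: x0; rewrite -Ee coset_repr_ray // => ->; rewrite !eqxx.
Qed.

Lemma vertex_shift h L : vertex L -> vertex (shift h L).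
Proof.
move=> /andP[aL sL]; rewrite /vertex all_repr_shift /=.
case: L aL sL => [|[r e] L] //= /andP[_ aL] pL.
by apply: (no_backtrack_shift (u := (_, e))) => //; case: (L) pL.
Qed.

Lemma vertex_behead u L : vertex (u :: L) -> vertex L.
Proof.
by rewrite /vertex /= => /andP[/andP[_ ->]] /path_sorted ->.
Qed.

Lemma vertex_cross e L : vertex L -> vertex (cross e L).
Proof.
move=> vL; rewrite /cross; case: L vL => [|[r e'] L] vL.
  by rewrite /vertex /= /repr_step /= proj0.
case: ifPn => [_|h]; first exact: vertex_behead vL.
case/andP: vL => aL sL; rewrite /vertex; apply/andP; split.
  by rewrite -cat1s all_cat aL andbT /= /repr_step /= proj0 eqxx.
by rewrite /= in sL *; rewrite sL andbT.
Qed.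

(** If the first crossing cancels a step, absence of backtracking ensures that the second puts it
    back instead of cancelling another one. *)
Lemma crossK e L : vertex L -> cross (inv_edge e) (cross e L) = L.
Proof.
case: L => [|[r e'] L] vL; first by rewrite /= inv_edgeK !eqxx.
rewrite /cross; case: ifPn => [/andP[/eqP r0 /eqP Ee]|_]; last first.
  by rewrite inv_edgeK !eqxx.
move: vL; rewrite r0 Ee; case: L => [|[r' e''] L] //=.
rewrite /vertex /= => /andP[_ /andP[nb _]].
by rewrite (negbTE nb).
Qed.

(* c^2 s = s a and c^2 t = t b. *)
Lemma shift_cross e k L :
  vertex L -> shift (ray e k) (cross e L) = cross e (shift (ray (inv_edge e) k) L).
Proof.
case: L => [|[r e'] L] vL /=.
  by rewrite add0r /coset_repr -[ray e k]add0r projD_ray proj0 !add0r subrr.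
have /eqP /= r0 : repr_step (r, e') by case/andP: vL => /andP[].
case: ifPn => [/andP[/eqP -> /eqP ->]|h].
  rewrite add0r /coset_repr -[ray _ k in RHS]add0r projD_ray proj0 add0r.
  by rewrite add0r subrr !eqxx /= inv_edgeK.
rewrite ifN /=; last first.
  apply: contra h => /andP[/eqP x0 /eqP Ee]; rewrite Ee eqxx andbT.
  by rewrite -x0 -Ee coset_repr_ray.
by rewrite add0r /coset_repr -[ray e k]add0r projD_ray proj0 !add0r subrr.
Qed.

(** A translation permutes the cosets of an edge subgroup, so the two paths still part at the same
    depth. *)
Lemma tree_dist_shift h L M :
  all repr_step L -> all repr_step M ->
  tree_dist (shift h L) (shift h M) = tree_dist L M.
Proof.
elim: L M h => [|[r e] L IH] M h aL aM.
  by rewrite /= size_shift.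
case: M aM => [|[r' e'] M] aM; first by rewrite /= size_shift.
move: aL aM => /= /andP[/eqP /= r0 aL] /andP[/eqP /= r'0 aM].
rewrite !size_shift !step_eqE.
have [Ee|ne] := eqVneq e e'; last by rewrite !andbF.
rewrite -Ee in r'0 *; rewrite !andbT; have [<-|nr] := eqVneq r r'; first by rewrite eqxx IH.
rewrite ifN //; apply: contra nr => /eqP E; apply/eqP.
exact: coset_repr_inj E.
Qed.

Definition starts (e : edge) (L : seq step) : bool :=
  if L is u :: _ then u == (0, e) else false.

Lemma crossN e L : ~~ starts (inv_edge e) L -> cross e L = (0, e) :: L.
Proof.
by case: L => [|[r e'] L] //=; rewrite step_eqE => /negbTE ->.
Qed.

Lemma crossS e L : cross e ((0, inv_edge e) :: L) = L.
Proof. by rewrite /= !eqxx. Qed.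

Lemma startsP e L : reflect (exists L', L = (0, e) :: L') (starts e L).
Proof.
case: L => [|u L] /=; first by constructor; case.
by apply: (iffP eqP) => [->|[L' [-> _]]]; first by exists L.
Qed.

Lemma tree_distC (T : eqType) (L M : seq T) : tree_dist L M = tree_dist M L.
Proof.
elim: L M => [|x L IH] [|y M] //=; rewrite eq_sym IH.
by rewrite [in RHS]addnC.
Qed.

(** The geodesic from [L] to [M] passes through the root, before and after crossing; one arm loses a
    step and the other gains one. *)
Lemma tree_dist_cross_mixed e L M :
  vertex L -> starts (inv_edge e) L -> ~~ starts (inv_edge e) M ->
  tree_dist (cross e L) (cross e M) = tree_dist L M.
Proof.
move=> vL /startsP[L' EL] sM; rewrite (crossN sM); move: vL; rewrite EL crossS => vL.
have -> : tree_dist ((0, inv_edge e) :: L') M = ((size L').+1 + size M)%N.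
  by case: M sM => [|v M] /=; rewrite ?addn0 // eq_sym => /negbTE ->.
have /negP nL' : ~ starts e L'.
  move=> /startsP[L'' EL']; move: vL; rewrite EL' /vertex /= /no_backtrack /=.
  by rewrite inv_edgeK !eqxx /= andbF.
case: L' nL' {EL vL} => [|v L'] /= => [_|/negbTE ->]; first by rewrite add1n.
by rewrite !addSn addnS.
Qed.

Lemma tree_dist_cross e L M :
  vertex L -> vertex M -> tree_dist (cross e L) (cross e M) = tree_dist L M.
Proof.
move=> vL vM.
have [sL|sL] := boolP (starts (inv_edge e) L);
have [sM|sM] := boolP (starts (inv_edge e) M).
- by move: sL sM => /startsP[L' ->] /startsP[M' ->]; rewrite !crossS tree_dist_cons.
- exact: tree_dist_cross_mixed.
- by rewrite tree_distC tree_dist_cross_mixed // tree_distC.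
- by rewrite !crossN // tree_dist_cons.
Qed.

(** By [proj_ray_le] the coefficient stays within 4 however long [L] is; the final 8 comes from c^2
    = (2, 2). *)
Lemma carry_ray_le e k L :
  all repr_step L -> (`|k| <= 4)%N ->
  (`|(carry (ray e k) L).1|%N <= 8)%N /\ (`|(carry (ray e k) L).2|%N <= 8)%N.
Proof.
elim: L e k => [|[r e'] L IH] e k /=.
  by move=> _; case: e => [[] []] /=; lia.
move=> /andP[/eqP /= r0 aL] k4; apply: IH => //; exact: proj_ray_le.
Qed.

Lemma carry_unit_le h L :
  all repr_step L -> (`|h.1| <= 1)%N -> (`|h.2| <= 1)%N ->
  (`|(carry h L).1|%N <= 8)%N /\ (`|(carry h L).2|%N <= 8)%N.
Proof.
case: L => [|[r e] L] /=; first by lia.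
move=> /andP[/eqP /= r0 aL] h1 h2; apply: carry_ray_le => //.
exact: proj_unit_le.
Qed.

(** * The action of words on the tree and its cocycle with values in Z^2 *)

Definition unit_vec (g : gen) : Z2 :=
  match g with
  | gen_a => (1, 0) | gen_b => (0, 1) | gen_c => (1, 1) | _ => 0
  end.

Definition letter_vec (l : gen * bool) : Z2 :=
  if l.2 then - unit_vec l.1 else unit_vec l.1.

Definition stable_edge (l : gen * bool) : option edge :=
  match l.1 with
  | gen_s => Some (false, l.2) | gen_t => Some (true, l.2) | _ => None
  end.

Definition letter_act (l : gen * bool) (L : seq step) : seq step :=
  if stable_edge l is Some e then cross e L else shift (letter_vec l) L.

Definition letter_carry (l : gen * bool) (L : seq step) : Z2 :=
  if stable_edge l is Some e then 0 else carry (letter_vec l) L.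

Definition word_act (w : word gen) (L : seq step) : seq step :=
  foldr letter_act L w.

Fixpoint word_carry (w : word gen) (L : seq step) : Z2 :=
  if w is l :: w' then letter_carry l (word_act w' L) + word_carry w' L else 0.

Lemma vertex_letter_act l L : vertex L -> vertex (letter_act l L).
Proof.
rewrite /letter_act; case: stable_edge => [e|]; first exact: vertex_cross.
exact: vertex_shift.
Qed.

Lemma vertex_word_act w L : vertex L -> vertex (word_act w L).
Proof. by move=> vL; elim: w => [|l w IH] //=; exact: vertex_letter_act. Qed.

Lemma letter_actK l L : vertex L -> letter_act l (letter_act (inv_letter l) L) = L.
Proof.
move=> vL; have /andP[aL _] := vL.
case: l => g b; rewrite /letter_act /letter_vec; case: g => /=; last first.
- have := crossK (true, ~~ b) vL; by rewrite /inv_edge /= negbK.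
- have := crossK (false, ~~ b) vL; by rewrite /inv_edge /= negbK.
all: by rewrite shiftD; case: b; rewrite /= ?addrN ?addNr shift0.
Qed.

Lemma word_act_rel u v L :
  (u, v) \in G_rels -> vertex L -> word_act u L = word_act v L.
Proof.
move=> uv vL; have /andP[aL _] := vL.
(* The relations c^2 = sas^-1 and c^2 = tbt^-1 on the tree: move the shift across the inverse
   letter, then cancel the two crossings. *)
have cE e : shift (2, 2) L = cross (e, false) (shift (ray (e, true) 1) (cross (e, true) L)).
  by rewrite shift_cross //; symmetry; case: e;
     [apply: (crossK (true, true)) | apply: (crossK (false, true))]; exact: vertex_shift.
move: uv; rewrite !inE !xpair_eqE => /or4P[] /andP[/eqP -> /eqP ->];
  rewrite /word_act /= /letter_act /= /letter_vec /= ?shiftD //.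
by rewrite -(cE false) -(cE true).
Qed.

Lemma word_act_cat u v L : word_act (u ++ v) L = word_act u (word_act v L).
Proof. exact: foldr_cat. Qed.

(** This lets the action of words on vertices descend to the group. *)
Lemma pres_eq_word_act u v :
  pres_eq G_rels u v -> forall L, vertex L -> word_act u L = word_act v L.
Proof.
elim=> {u v} [||u v w _ IH1 _ IH2|u u' v v' _ IH1 _ IH2|l|u v uv] //.
- by move=> u v _ IH L vL; rewrite IH.
- by move=> L vL; rewrite IH1 ?IH2.
- by move=> L vL; rewrite !word_act_cat IH2 // IH1 //; exact: vertex_word_act.
- by move=> L vL; exact: letter_actK.
- by move=> L vL; exact: word_act_rel.
Qed.

Lemma tree_dist_letter_act l L M :
  vertex L -> vertex M -> tree_dist (letter_act l L) (letter_act l M) = tree_dist L M.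
Proof.
move=> vL vM; rewrite /letter_act; case: stable_edge => [e|].
  exact: tree_dist_cross.
by move: vL vM => /andP[aL _] /andP[aM _]; exact: tree_dist_shift.
Qed.

Lemma tree_dist_word_act w L M :
  vertex L -> vertex M -> tree_dist (word_act w L) (word_act w M) = tree_dist L M.
Proof.
move=> vL vM; elim: w => [|l w IH] //=.
by rewrite tree_dist_letter_act //; exact: vertex_word_act.
Qed.

Lemma size_letter_act l L : (size (letter_act l L) <= (size L).+1)%N.
Proof.
rewrite /letter_act; case: stable_edge => [e|]; last by rewrite size_shift.
by case: L => [|[r e'] L] //=; case: ifP => //= _; lia.
Qed.

Lemma size_word_act w : (size (word_act w [::]) <= size w)%N.
Proof.
elim: w => [|l w IH] //=; apply: leq_trans (size_letter_act _ _) _.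
by rewrite ltnS.
Qed.

Lemma word_carry_le w L :
  vertex L ->
  (`|(word_carry w L).1|%N <= 8 * size w)%N /\
  (`|(word_carry w L).2|%N <= 8 * size w)%N.
Proof.
move=> vL; elim: w => [|l w [IH1 IH2]] //=.
suff [h1 h2] : (`|(letter_carry l (word_act w L)).1|%N <= 8)%N /\
   (`|(letter_carry l (word_act w L)).2|%N <= 8)%N.
  by lia.
have /andP[aw _] := vertex_word_act w vL.
rewrite /letter_carry; case: stable_edge => [e|] //.
by apply: carry_unit_le => //; case: l => [[] []].
Qed.

(** * Integer powers in a group *)

Section IntegerPowers.
Local Open Scope group_scope.
Context {H : groupType}.
Implicit Types (x y : H) (k l : int).

Definition zpow x k : H :=
  match k with Posz n => x ^+ n | Negz n => x ^- n.+1 end.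

Lemma zpowN x (n : nat) : zpow x (- n%:Z)%R = x ^- n.
Proof. by case: n => [|n] //=; rewrite invg1. Qed.

Lemma zpow_succ x k : zpow x (k + 1)%R = zpow x k * x.
Proof.
case: k => n; first by rewrite -PoszD addn1 /= expgSr.
rewrite NegzE (_ : (- n.+1%:Z + 1)%R = (- n%:Z)%R); last by lia.
by rewrite !zpowN expgS invgM mulgVK.
Qed.

Lemma zpow_pred x k : zpow x (k - 1)%R = zpow x k * x^-1.
Proof. by rewrite -[in RHS](subrK 1%R k) zpow_succ mulgK. Qed.

Lemma zpowD x k l : zpow x (k + l)%R = zpow x k * zpow x l.
Proof.
elim/int_ind: l => [|n IH|n IH]; first by rewrite addr0 mulg1.
- by rewrite -addn1 PoszD addrA !zpow_succ IH mulgA.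
- by rewrite -addn1 PoszD opprD addrA !zpow_pred IH mulgA.
Qed.

Lemma commute_zpow x y k l : commute x y -> commute (zpow x k) (zpow y l).
Proof.
move=> xy; have commute_zpowr z t m : commute z t -> commute z (zpow t m).
  by case: m => n zt /=; [|apply: commuteV]; apply: commuteX.
by apply/commute_zpowr/commute_sym/commute_zpowr/commute_sym.
Qed.

Lemma zpowMl x y k : commute x y -> zpow (x * y) k = zpow x k * zpow y k.
Proof.
move=> xy; case: k => n /=; first exact: expgMn.
rewrite expgMn // -invgM; congr (_^-1).
exact/commuteX2.
Qed.

Lemma zpow_semiconj x y z k : x * z = z * y -> zpow x k * z = z * zpow y k.
Proof.
move=> xz; elim/int_ind: k => [|n IH|n IH]; first by rewrite mul1g mulg1.
- by rewrite -addn1 PoszD !zpow_succ -mulgA xz !mulgA IH.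
- rewrite -addn1 PoszD opprD !zpow_pred -mulgA.
  have -> : x^-1 * z = z * y^-1.
    by apply: (mulgI x); rewrite mulVKg mulgA xz mulgK.
  by rewrite !mulgA IH.
Qed.

End IntegerPowers.

(** * Normal forms in the group, geodesic triangles and the stabilizer bound *)

Section NormalForms.
Local Open Scope group_scope.

Definition letter_elt (l : gen * bool) : G := \pi_(pres_group G_rels) [:: l].

Lemma pi_cat u v :
  \pi_(pres_group G_rels) (u ++ v) =
  (\pi_(pres_group G_rels) u : G) * (\pi_(pres_group G_rels) v : G).
Proof. by rewrite -pres_mul_pi. Qed.

Lemma pi_cons l w :
  \pi_(pres_group G_rels) (l :: w) =
  letter_elt l * (\pi_(pres_group G_rels) w : G).
Proof. exact: (pi_cat [:: l]). Qed.

Lemma pi_nil : \pi_(pres_group G_rels) [::] = 1 :> G.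
Proof. by []. Qed.

Lemma letter_eltV l : letter_elt (inv_letter l) = (letter_elt l)^-1.
Proof.
apply: (mulgI (letter_elt l)); rewrite mulgV -pi_cons.
by apply/pi_pres_eq; exact: pres_cancel.
Qed.

Definition gen_elt (g : gen) : G := letter_elt (g, false).

Lemma letter_elt_inv g : letter_elt (g, true) = (gen_elt g)^-1.
Proof. exact: (letter_eltV (g, false)). Qed.

Lemma pi_rel u v :
  (u, v) \in G_rels ->
  \pi_(pres_group G_rels) u = \pi_(pres_group G_rels) v :> G.
Proof. by move=> uv; apply/pi_pres_eq; exact: pres_rel. Qed.

Lemma gen_c_ab : gen_elt gen_c = gen_elt gen_a * gen_elt gen_b.
Proof.
have := pi_rel (mem_nth ([::], [::]) (isT : 0 < size G_rels)%N).
by rewrite /= !pi_cons pi_nil !mulg1.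
Qed.

Lemma commute_ab : commute (gen_elt gen_a) (gen_elt gen_b).
Proof.
have := pi_rel (mem_nth ([::], [::]) (isT : 1 < size G_rels)%N).
by rewrite /= !pi_cons pi_nil !mulg1.
Qed.

Lemma gen_c_s :
  gen_elt gen_c * gen_elt gen_c = gen_elt gen_s * gen_elt gen_a * (gen_elt gen_s)^-1.
Proof.
have := pi_rel (mem_nth ([::], [::]) (isT : 2 < size G_rels)%N).
by rewrite /= !pi_cons pi_nil !mulg1 letter_elt_inv !mulgA.
Qed.

Lemma gen_c_t :
  gen_elt gen_c * gen_elt gen_c = gen_elt gen_t * gen_elt gen_b * (gen_elt gen_t)^-1.
Proof.
have := pi_rel (mem_nth ([::], [::]) (isT : 3 < size G_rels)%N).
by rewrite gen_c_s /= !pi_cons pi_nil !mulg1 !letter_elt_inv !mulgA.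
Qed.

Definition vec_elt (h : Z2) : G := zpow (gen_elt gen_a) h.1 * zpow (gen_elt gen_b) h.2.

Lemma vec_eltD h h' : vec_elt (h + h')%R = vec_elt h * vec_elt h'.
Proof.
rewrite /vec_elt !zpowD -!mulgA; congr (_ * _); rewrite !mulgA; congr (_ * _).
exact/commute_zpow/commute_ab.
Qed.

Definition edge_elt (e : edge) : G :=
  letter_elt (if e.1 then gen_t else gen_s, e.2).

Lemma edge_eltV e : edge_elt (inv_edge e) = (edge_elt e)^-1.
Proof. by rewrite -letter_eltV. Qed.

(** The k-th powers of the relations c^2 = sas^-1 and c^2 = tbt^-1. *)
Lemma ray_edge_false i k :
  vec_elt (ray (i, false) k) * edge_elt (i, false) =
  edge_elt (i, false) * vec_elt (ray (i, true) k).
Proof.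
have cc : vec_elt (ray (i, false) k) = zpow (gen_elt gen_c * gen_elt gen_c) k.
  rewrite zpowMl ?commute_refl // -zpowD gen_c_ab zpowMl; last exact: commute_ab.
  by rewrite /vec_elt /ray; case: i; rewrite (_ : (2 * k = k + k)%R) //; lia.
rewrite cc; case: {cc} i => /=.
- have -> : vec_elt (ray (true, true) k) = zpow (gen_elt gen_b) k by exact: mul1g.
  by apply: zpow_semiconj; rewrite gen_c_t mulgVK.
- have -> : vec_elt (ray (false, true) k) = zpow (gen_elt gen_a) k by exact: mulg1.
  by apply: zpow_semiconj; rewrite gen_c_s mulgVK.
Qed.

Lemma ray_edge e k :
  vec_elt (ray e k) * edge_elt e = edge_elt e * vec_elt (ray (inv_edge e) k).
Proof.
case: e => i []; last exact: ray_edge_false.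
have -> : edge_elt (i, true) = (edge_elt (i, false))^-1 by rewrite -edge_eltV.
apply: (mulgI (edge_elt (i, false))); rewrite mulgA -ray_edge_false mulgK.
by rewrite mulVKg.
Qed.

(** The representative of the coset of <a, b> that the vertex encodes. *)
Fixpoint vertex_elt (L : seq step) : G :=
  if L is (r, e) :: L' then vec_elt r * edge_elt e * vertex_elt L' else 1.

Lemma vec_elt0 : vec_elt 0%R = 1.
Proof. exact: mulg1. Qed.

Lemma shift_carry h L :
  vec_elt h * vertex_elt L = vertex_elt (shift h L) * vec_elt (carry h L).
Proof.
elim: L h => [|[r e] L IH] h /=; first by rewrite mulg1 mul1g.
rewrite -[RHS]mulgA -IH [LHS]mulgA [X in X * _]mulgA -vec_eltD addrC.
rewrite -[X in vec_elt X](coset_reprE e) vec_eltD -[X in X * _]mulgA ray_edge.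
by rewrite [X in X * _]mulgA -[LHS]mulgA.
Qed.

Lemma cross_elt e L : edge_elt e * vertex_elt L = vertex_elt (cross e L).
Proof.
case: L => [|[r e'] L] /=; first by rewrite vec_elt0 mul1g.
case: ifP => [/andP[/eqP -> /eqP ->]|_] /=; rewrite vec_elt0 mul1g //.
by rewrite edge_eltV mulVKg.
Qed.

Lemma letter_act_carry l L :
  letter_elt l * vertex_elt L = vertex_elt (letter_act l L) * vec_elt (letter_carry l L).
Proof.
have letter_vecE : stable_edge l = None -> letter_elt l = vec_elt (letter_vec l).
  have gE g : stable_edge (g, false) = None -> gen_elt g = vec_elt (unit_vec g).
    by case: g => //= _; rewrite /vec_elt /= ?mulg1 ?mul1g // gen_c_ab.
  case: l => g [] /= El; last exact: gE.
  rewrite letter_elt_inv gE; last by case: g El.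
  apply: (mulgI (vec_elt (unit_vec g))).
  by rewrite mulgV -vec_eltD addrN vec_elt0.
rewrite /letter_act /letter_carry; case El: stable_edge => [e|].
  rewrite vec_elt0 mulg1 -cross_elt; congr (_ * _).
  by case: l El {letter_vecE} => [[] b] //= [<-].
by rewrite letter_vecE // shift_carry.
Qed.

(** With source and target vertex fixed, this recovers the group element from its carry. *)
Lemma word_act_carry w L :
  (\pi_(pres_group G_rels) w : G) * vertex_elt L =
  vertex_elt (word_act w L) * vec_elt (word_carry w L).
Proof.
elim: w => [|l w IH] /=; first by rewrite vec_elt0 mulg1 pi_nil mul1g.
by rewrite pi_cons -mulgA IH mulgA letter_act_carry -mulgA -vec_eltD.
Qed.

Definition tree_act (x : G) (L : seq step) : seq step := word_act (repr x) L.

Lemma tree_act_pi w L :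
  vertex L -> tree_act (\pi_(pres_group G_rels) w) L = word_act w L.
Proof. by move=> vL; apply: pres_eq_word_act vL; exact: pres_eq_repr. Qed.

Lemma vertex_tree_act x L : vertex L -> vertex (tree_act x L).
Proof. exact: vertex_word_act. Qed.

Lemma tree_actM x y L :
  vertex L -> tree_act (x * y) L = tree_act x (tree_act y L).
Proof. by move=> vL; rewrite tree_act_pi // word_act_cat. Qed.

Lemma tree_act1 L : vertex L -> tree_act 1 L = L.
Proof. by move=> vL; rewrite -pi_nil tree_act_pi. Qed.

Lemma tree_dist_act x L M :
  vertex L -> vertex M -> tree_dist (tree_act x L) (tree_act x M) = tree_dist L M.
Proof. exact: tree_dist_word_act. Qed.

Lemma G_length_word (x : G) :
  exists2 w, \pi_(pres_group G_rels) w = x & size w = G_length x.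
Proof. by rewrite /G_length /word_length; case: ex_minnP => n /asboolP. Qed.

Lemma size_tree_act x : (size (tree_act x [::]) <= G_length x)%N.
Proof.
have [w <- <-] := G_length_word x.
by rewrite tree_act_pi //; exact: size_word_act.
Qed.

(* The vertex at distance i from the root on the geodesic to the image of the
   root under x. *)
Definition geodesic (i : nat) (x : G) : seq step := take i (tree_act x [::]).

Lemma vertex_take i L : vertex L -> vertex (take i L).
Proof.
move=> /andP[aL sL]; apply/andP; split; last exact: take_sorted.
by apply/allP => u /mem_take; exact: (allP aL).
Qed.

Lemma vertex_geodesic i x : vertex (geodesic i x).
Proof. by apply/vertex_take/vertex_tree_act. Qed.

(* The three sides of the geodesic triangle root, x root, z root meet in the
   common prefix of the last two vertices. *)
Lemma geodesic_triangle x z : exists i j : nat,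
  [/\ (i <= G_length x)%N, (j <= G_length x)%N, geodesic i x = geodesic i z &
      geodesic i z = tree_act x (geodesic j (x^-1 * z))].
Proof.
set X := tree_act x [::]; set Z := tree_act z [::]; set p := common_prefix X Z.
have vX : vertex X by exact: vertex_tree_act.
have vZ : vertex Z by exact: vertex_tree_act.
have pX : p = take (size p) X := common_prefixE X Z.
have pZ : p = take (size p) Z.
  by rewrite /p common_prefixC; exact: common_prefixE.
have vp : vertex p by rewrite pX; exact: vertex_take.
set q := tree_act x^-1 p; set L := tree_act (x^-1 * z) [::].
have vq : vertex q by exact: vertex_tree_act.
have vL : vertex L by exact: vertex_tree_act.
have xq : tree_act x q = p by rewrite -tree_actM // mulgV tree_act1.
have xL : tree_act x L = Z by rewrite -tree_actM // mulVKg.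
have sq : size q = tree_dist X p.
  by rewrite -[size q]/(tree_dist [::] q) -(tree_dist_act x) // xq.
have spX : (size p + size q = size X)%N by rewrite sq size_common_prefix.
have lX : (size X <= G_length x)%N := size_tree_act x.
exists (size p), (size q); split; rewrite /geodesic -/X -/Z -?pX -?pZ //.
- by apply: leq_trans lX; rewrite -spX leq_addr.
- by apply: leq_trans lX; rewrite -spX leq_addl.
(* That [q] lies on the geodesic from the root to [L] becomes, after applying [x], that [p] lies
   between [X] and [Z]. *)
rewrite -/L -prefix_of_tree_dist ?xq //.
rewrite sq -(tree_dist_act x vq vL) xq xL tree_dist_common_prefix.
by rewrite -[size L]/(tree_dist [::] L) -(@tree_dist_act x [::] L) // xL.
Qed.

(** By [word_act_carry] such an element is determined by its carry at [q], whose two coordinates lie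
    between -8n and 8n. *)
Lemma ball_stabilizer_bound n p q (s : seq G) :
  vertex q -> uniq s ->
  (forall x, x \in s -> (G_length x <= n)%N /\ tree_act x q = p) ->
  (size s <= (16 * n).+1 ^ 2)%N.
Proof.
move=> vq us sP.
pose I : seq int := [seq (i%:Z - (8 * n)%:Z)%R | i <- iota 0 (16 * n).+1].
have memI (k : int) : (`|k| <= 8 * n)%N -> k \in I.
  move=> kn; apply/mapP; exists (absz (k + (8 * n)%:Z)%R); last by lia.
  by rewrite mem_iota; lia.
pose f (h : int * int) : G := vertex_elt p * vec_elt h * (vertex_elt q)^-1.
have -> : ((16 * n).+1 ^ 2)%N = size (map f (allpairs pair I I)).
  by rewrite size_map size_allpairs size_map size_iota mulnn.
apply: uniq_leq_size => // x /sP[lx xqp].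
have [w Ew sw] := G_length_word x.
have [c1 c2] := word_carry_le w vq.
apply/mapP; exists (word_carry w q).
  apply/allpairsP; exists (word_carry w q); split; last by case: word_carry.
  - by apply: memI; apply: leq_trans c1 _; rewrite leq_mul2l sw lx orbT.
  - by apply: memI; apply: leq_trans c2 _; rewrite leq_mul2l sw lx orbT.
by rewrite /f -xqp -Ew tree_act_pi // -word_act_carry mulgK.
Qed.

End NormalForms.

(** * Inequalities for finite sums *)

Section Sums.
Context {R : realType}.

Lemma cauchy_schwarz_sum (I : Type) (s : seq I) (P : pred I) (a b : I -> R) :
  (\sum_(i <- s | P i) a i * b i) ^+ 2 <=
  (\sum_(i <- s | P i) a i ^+ 2) * (\sum_(i <- s | P i) b i ^+ 2).
Proof.
set A := \sum_(i <- s | P i) a i ^+ 2; set B := \sum_(i <- s | P i) b i ^+ 2.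
set C := \sum_(i <- s | P i) a i * b i.
(* Lagrange's identity: this double sum is twice the difference of the two sides. *)
have : 0 <= \sum_(i <- s | P i) \sum_(j <- s | P j) (a i * b j - a j * b i) ^+ 2.
  by apply: sumr_ge0 => i _; apply: sumr_ge0 => j _; exact: sqr_ge0.
have -> : \sum_(i <- s | P i) \sum_(j <- s | P j) (a i * b j - a j * b i) ^+ 2 =
    A * B + A * B - (C * C + C * C).
  rewrite {2}[A * B]mulrC /A /B /C !big_distrlr /= -!big_split -sumrB /=.
  apply: eq_bigr => i _; rewrite -!big_split -sumrB /=.
  by apply: eq_bigr => j _; ring.
by rewrite expr2; nra.
Qed.

Lemma ler_sum_uniq (T : eqType) (s t : seq T) (K : T -> R) :
  uniq s -> uniq t -> (forall x, 0 <= K x) -> (forall x, x \notin t -> K x = 0) ->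
  \sum_(x <- s) K x <= \sum_(x <- t) K x.
Proof.
move=> us ut K0 Kt; rewrite (bigID (mem t)) /= [X in _ + X]big1 // addr0.
rewrite [leRHS](bigID (mem s)) /= -[leLHS]addr0 lerD ?sumr_ge0 //.
rewrite -big_filter -[leRHS]big_filter (perm_big [seq x <- t | x \in s]) //=.
by apply: uniq_perm; rewrite ?filter_uniq // => x; rewrite !mem_filter andbC.
Qed.

Lemma normc_ge0 (x : R[i]) : 0 <= Normc.normc x.
Proof. by case: x => a b; exact: sqrtr_ge0. Qed.

Lemma normc_sum_le (I : Type) (s : seq I) (f : I -> R[i]) :
  Normc.normc (\sum_(i <- s) f i) <= \sum_(i <- s) Normc.normc (f i).
Proof.
elim/big_ind2: _ => [|x a y b xa yb|//]; first by rewrite Normc.normc0.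
by apply: le_trans (le_normcD _ _) _; exact: lerD.
Qed.

End Sums.

(** * The convolution estimate from centres of triangles *)

(* The tree enters only through the maps p i, sending x to the i-th vertex on the
   geodesic from the root v to x v; act need not even be an action. *)
Section CentroidCriterion.
Context {R : realType} {H : groupType} {V : eqType}.
Variables (len : H -> nat) (act : H -> V -> V) (p : nat -> H -> V) (m : nat -> nat).
Hypothesis centroid : forall x z, exists i j : nat,
  [/\ (i <= len x)%N, (j <= len x)%N, p i x = p i z &
      p i z = act x (p j (x^-1 * z)%g)].
Hypothesis stabilizer_bound : forall n j y v (s : seq H), uniq s ->
  (forall x, x \in s -> (len x <= n)%N /\ act x (p j y) = v) ->
  (size s <= m n ^ 2)%N.

Section Localized.
Variables (n : nat) (S Y : seq H) (F K : H -> R).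
Hypotheses (uS : uniq S) (lS : forall x, x \in S -> (len x <= n)%N).
Hypotheses (uY : uniq Y) (KY : forall y, y \notin Y -> K y = 0).
Hypotheses (F0 : forall x, 0 <= F x) (K0 : forall y, 0 <= K y).

Let cut (i j : nat) (x z : H) : bool :=
  (p i x == p i z) && (p i z == act x (p j (x^-1 * z)%g)).

Let T (i j : nat) (z : H) : R := \sum_(x <- S | cut i j x z) F x * K (x^-1 * z)%g.

(** Substitute y = x^-1 z: for each [y], the remaining condition on [x] is met by at most [m n ^ 2]
    elements of [S]. *)
Lemma sum_fibre_le j v (Z : seq H) : uniq Z ->
  \sum_(z <- Z) \sum_(x <- S | v == act x (p j (x^-1 * z)%g)) K (x^-1 * z)%g ^+ 2
  <= (m n ^ 2)%:R * \sum_(y <- Y) K y ^+ 2.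
Proof.
move=> uZ; under eq_bigr do rewrite big_mkcond /=.
rewrite exchange_big /=.
pose phi x y := if v == act x (p j y) then K y ^+ 2 else 0.
apply: (@le_trans _ _ (\sum_(x <- S) \sum_(y <- Y) phi x y)).
  apply: ler_sum => x _.
  rewrite -(big_map (fun z => x^-1 * z)%g predT (phi x)) /=.
  apply: ler_sum_uniq => // [|y|y yY].
  - by rewrite map_inj_uniq //; exact: mulgI.
  - by rewrite /phi; case: ifP => // _; exact: sqr_ge0.
  - by rewrite /phi KY // expr0n if_same.
rewrite exchange_big /= mulr_sumr; apply: ler_sum => y _.
rewrite -big_mkcond /= big_const_seq iter_addr addr0 -[leLHS]mulr_natl.
rewrite ler_wpM2r ?sqr_ge0 // ler_nat -size_filter.
apply: (@stabilizer_bound n j y v); first exact: filter_uniq.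
by move=> x; rewrite mem_filter => /andP[/eqP <- /lS].
Qed.

(** Cauchy-Schwarz separates the two conditions of [cut]: the first stays with [F], the second with
    [K]. Replacing [p i z] by [p i x] then makes the vertex independent of [z], and [sum_fibre_le]
    bounds the sum over [z]. *)
Lemma sum_cut_sqr_le i j (Z : seq H) : uniq Z ->
  \sum_(z <- Z) T i j z ^+ 2 <=
  (m n ^ 2)%:R * (\sum_(x <- S) F x ^+ 2) * (\sum_(y <- Y) K y ^+ 2).
Proof.
move=> uZ.
pose Q v z := \sum_(x <- S | v == act x (p j (x^-1 * z)%g)) K (x^-1 * z)%g ^+ 2.
have Q0 v z : 0 <= Q v z by apply: sumr_ge0 => *; exact: sqr_ge0.
apply: (@le_trans _ _ (\sum_(z <- Z) \sum_(x <- S) F x ^+ 2 * Q (p i x) z)).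
  apply: ler_sum => z _; apply: le_trans (cauchy_schwarz_sum _ _ _ _) _.
  apply: (@le_trans _ _ ((\sum_(x <- S | p i x == p i z) F x ^+ 2) * Q (p i z) z)).
    apply: ler_pM; try by apply: sumr_ge0 => *; exact: sqr_ge0.
    - rewrite big_mkcond [leRHS]big_mkcond /=; apply: ler_sum => x _.
      by rewrite /cut; case: eqP => //= _; case: ifP => // _; exact: sqr_ge0.
    - rewrite /Q big_mkcond [leRHS]big_mkcond /=; apply: ler_sum => x _.
      by rewrite /cut andbC; case: eqP => //= _; case: ifP => // _; exact: sqr_ge0.
  rewrite mulr_suml big_mkcond /=; apply: ler_sum => x _.
  by case: eqP => [->|_] //; rewrite mulr_ge0 ?sqr_ge0.
rewrite exchange_big /= mulrAC mulrC mulr_suml; apply: ler_sum => x _.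
rewrite -mulr_sumr ler_wpM2l ?sqr_ge0 //; exact: sum_fibre_le.
Qed.

(** By [centroid] every term occurs in some cut; repeated occurrences only increase the right side,
    as all terms are nonnegative. *)
Lemma convolution_le_cut z :
  \sum_(x <- S) F x * K (x^-1 * z)%g <=
  \sum_(k : 'I_n.+1 * 'I_n.+1) T k.1 k.2 z.
Proof.
rewrite /T; under [leRHS]eq_bigr do rewrite big_mkcond /=.
rewrite exchange_big /= big_seq [leRHS]big_seq; apply: ler_sum => x xS.
have [i [j [li lj pi pj]]] := centroid x z.
have ln : (len x < n.+1)%N by rewrite ltnS lS.
rewrite (bigD1 (Ordinal (leq_ltn_trans li ln), Ordinal (leq_ltn_trans lj ln))) //=.
have -> : cut i j x z by rewrite /cut pi -pj !eqxx.
rewrite lerDl; apply: sumr_ge0 => k _.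
by case: ifP => // _; exact: mulr_ge0.
Qed.

Lemma sum_convolution_sqr_le (Z : seq H) : uniq Z ->
  \sum_(z <- Z) (\sum_(x <- S) F x * K (x^-1 * z)%g) ^+ 2 <=
  ((n.+1 ^ 2 * m n) ^ 2)%:R * ((\sum_(x <- S) F x ^+ 2) * (\sum_(y <- Y) K y ^+ 2)).
Proof.
move=> uZ; set A := \sum_(x <- S) _; set B := \sum_(y <- Y) _.
have cardN : #|{: 'I_n.+1 * 'I_n.+1}| = (n.+1 ^ 2)%N.
  by rewrite card_prod card_ord mulnn.
apply: (@le_trans _ _ (\sum_(z <- Z) (n.+1 ^ 2)%:R *
    \sum_(k : 'I_n.+1 * 'I_n.+1) T k.1 k.2 z ^+ 2)).
  apply: ler_sum => z _.
  (* Cauchy-Schwarz against the constant 1 costs a factor (n + 1)^2, the number of cuts; summing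
     their bounds costs another. *)
  apply: (@le_trans _ _ ((\sum_(k : 'I_n.+1 * 'I_n.+1) T k.1 k.2 z * 1) ^+ 2)).
    rewrite ler_sqr ?nnegrE; last first.
    - by apply: sumr_ge0 => k _; rewrite mulr1; apply: sumr_ge0 => x _; exact: mulr_ge0.
    - by apply: sumr_ge0 => x _; exact: mulr_ge0.
    by under [leRHS]eq_bigr do rewrite mulr1; exact: convolution_le_cut.
  apply: le_trans (cauchy_schwarz_sum _ _ _ _) _.
  by rewrite expr1n sumr_const cardN mulrC.
have -> : ((n.+1 ^ 2 * m n) ^ 2)%:R = (n.+1 ^ 2)%:R * ((n.+1 ^ 2)%:R * (m n ^ 2)%:R) :> R.
  by rewrite -!natrM; congr (_%:R); ring.
rewrite -mulr_sumr exchange_big /= -mulrA.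
rewrite ler_wpM2l ?ler0n //.
apply: (@le_trans _ _ (\sum_(k : 'I_n.+1 * 'I_n.+1) (m n ^ 2)%:R * A * B)).
  by apply: ler_sum => k _; exact: sum_cut_sqr_le.
by rewrite sumr_const cardN -[leLHS]mulr_natl !mulrA.
Qed.

End Localized.

(** The triangle inequality reduces this to the moduli of [f] and [g], where the squared estimate
    applies. *)
Lemma l2norm_conv_le n (f g : group_algebra R H) :
  (forall x, x \in finsupp f -> (len x <= n)%N) ->
  l2norm (conv f g) <= (n.+1 ^ 2 * m n)%:R * l2norm f * l2norm g.
Proof.
move=> lf; pose F x := Normc.normc (f x); pose K y := Normc.normc (g y).
rewrite /l2norm -mulrA -sqrtrM ?sumr_ge0 // => [|x _]; last exact: sqr_ge0.
rewrite -{1}(ger0_norm (ler0n R (n.+1 ^ 2 * m n))) -sqrtr_sqr -sqrtrM ?sqr_ge0 //.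
rewrite ler_wsqrtr // -natrX.
have F0 x : 0 <= F x by exact: normc_ge0.
have K0 y : 0 <= K y by exact: normc_ge0.
have KN y : y \notin finsupp g -> K y = 0.
  by move=> yg; rewrite /K fsfun_dflt // Normc.normc0.
apply: le_trans (sum_convolution_sqr_le (fset_uniq _) lf (fset_uniq _) KN F0 K0
  (fset_uniq (finsupp (conv f g)))).
apply: ler_sum => z _; rewrite ler_sqr ?nnegrE ?normc_ge0 //; last first.
  by apply: sumr_ge0 => x _; apply: mulr_ge0; exact: normc_ge0.
rewrite convE; apply: le_trans (normc_sum_le _ _) _.
by apply: ler_sum => x _; rewrite Normc.normcM.
Qed.

End CentroidCriterion.

Theorem mainTheorem1 (R : realType) : @rapid_decay R G G_length.
Proof.
(* The first factor counts the positions (i, j); the second is the square root of the stabilizer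
   bound (16n + 1)^2. *)
exists (('X + 1) ^+ 2 * (16%:R *: 'X + 1)) => r r0 f g fr.
(* Lengths are integers, so the balls of radius [r] and [n] agree; the bound at [n] is at most that
   at [r]. *)
pose n := Num.truncn r.
have nr : n%:R <= r by rewrite truncn_le.
have fn x : x \in finsupp f -> (G_length x <= n)%N.
  by move=> /fr; rewrite truncn_ge_nat.
have bound k j y v s : uniq s ->
    (forall x, x \in s -> (G_length x <= k)%N /\ tree_act x (geodesic j y) = v) ->
    (size s <= (16 * k).+1 ^ 2)%N.
  exact/ball_stabilizer_bound/vertex_geodesic.
apply: le_trans (l2norm_conv_le (m := fun k => (16 * k).+1) geodesic_triangle bound g fn) _.
rewrite !ler_wpM2r ?sqrtr_ge0 // !hornerE natrM natrX -[(16 * n).+1]addn1.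
rewrite natrD natrM -[n.+1]addn1 natrD.
have n0 : 0 <= n%:R :> R by rewrite ler0n.
apply: ler_pM; rewrite ?exprn_ge0 ?addr_ge0 ?mulr_ge0 ?ler0n //.
- by rewrite ler_sqr ?nnegrE ?addr_ge0 // lerD2r.
- by rewrite lerD2r ler_wpM2l.
Qed.
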